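(* Let $a_9(n)$ be defined by \[\sum_{n\geq 0}a_9(n)q^n=\frac{f_9f_{18}}{f_1f_2},\qquad f_k=\prod_{m=1}^{\infty}(1-q^{km}).\] Then for every integer $\alpha\geq 0$ and every integer $n\geq 0$, \[a_9\left(3^{\alpha+1}n+3^{\alpha+1}-1\right)\equiv 0 \pmod{3^{\alpha+1}}.\]
   Context: $a_9(n)$ is the number of 9-regular cubic partitions of $n$; its generating function is as given, where $f_k=(q^k;q^k)_\infty$. *)

(* Defs.v *)
From mathcomp Require Import all_boot all_order all_algebra.
Set Implicit Arguments. Unset Strict Implicit. Unset Printing Implicit Defensive.
Import GRing.Theory Num.Theory.
Local Open Scope ring_scope.

(* Coefficient extraction for the q-series  f9 f18 / (f1 f2),
   f_k = prod_{m>=1} (1 - q^{km}).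
   The coefficient of q^n only depends on the series modulo q^(n+1):
   - factors (1 - q^{km}) with m > n are 1 mod q^(n+1);
   - 1/(1 - q^k) = sum_{j>=0} q^{kj} is exact mod q^(n+1) when truncated at j <= n.
   So a9 n is the n-th coefficient of the polynomial truncation below. *)

Definition geom_trunc (N k : nat) : {poly int} :=
  \sum_(0 <= j < N.+1) 'X^(k * j).

Definition gen9_trunc (N : nat) : {poly int} :=
  \prod_(1 <= m < N.+1)
     ((1 - 'X^(9 * m)) * (1 - 'X^(18 * m)) * geom_trunc N m * geom_trunc N (2 * m)).

Definition a9 (n : nat) : int := (gen9_trunc n)`_n.

(* Main.v *)
(* Put z = 3 q f_9 f_18 / (f_1 f_2) and let U keep the coefficients with index
   divisible by 3 (q^(3n) |-> q^n).  The cubic continued fraction gives a cubic equation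
     z^3 = 3 S(q^3) (1 + z + z^2)   with   S = 3 (z + z^2 + z^3),
   and U z = S, U z^2 = 2 S + 3 S^2, so U maps the Z-span of z, z^2, z^3, ... into 3 times
   itself.  Hence U^k z / 3 is divisible by 3^k, and its coefficient of q^(n+1) is
   a_9(3^k (n + 1) - 1).

   The cubic equation comes from the 3-dissections
     phi(q) = phi(q^9) (1 - 2 v),   psi(q) = A(q^3) (1 + v)
   of phi = f_1^2/f_2 and psi = f_2^2/f_1, whose product is f_1 f_2, together with the
   product of phi(w^i q) over the cube roots of unity w^i; the dissections themselves are
   read off the theta series supplied by the Jacobi triple product. *)

Require Import Defs.
From mathcomp Require Import all_boot all_order all_algebra.
From HB Require Import structures.
From mathcomp Require Import boolp zify ring.
Set Implicit Arguments. Unset Strict Implicit. Unset Printing Implicit Defensive.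
Import GRing.Theory Num.Theory.
Local Open Scope ring_scope.

(** * Formal power series over the integers *)

Record series := Series { coefs :> nat -> int }.

HB.instance Definition _ := gen_eqMixin series.
HB.instance Definition _ := gen_choiceMixin series.

Lemma seriesP (s t : series) : (forall n, s n = t n) -> s = t.
Proof. by case: s t => [s] [t] /= st; congr Series; apply: funext. Qed.

Definition add_series (s t : series) := Series (fun n => s n + t n).
Definition opp_series (s : series) := Series (fun n => - s n).
Definition mul_series (s t : series) :=
  Series (fun n => \sum_(i < n.+1) s i * t (n - i)%N).
Definition poly_series (p : {poly int}) := Series (fun n => p`_n).
Definition trunc_series N (s : series) : {poly int} := \poly_(i < N) s i.

Lemma add_seriesA : associative add_series.
Proof. by move=> s t r; apply: seriesP => n; apply: addrA. Qed.
Lemma add_seriesC : commutative add_series.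
Proof. by move=> s t; apply: seriesP => n; apply: addrC. Qed.
Lemma add_series0 : left_id (poly_series 0) add_series.
Proof. by move=> s; apply: seriesP => n; rewrite /= coef0 add0r. Qed.
Lemma add_seriesN : left_inverse (poly_series 0) opp_series add_series.
Proof. by move=> s; apply: seriesP => n; rewrite /= coef0 addNr. Qed.

HB.instance Definition _ :=
  GRing.isZmodule.Build series add_seriesA add_seriesC add_series0 add_seriesN.

(** A coefficient of a product involves finitely many terms, so commutativity and associativity are
    inherited from polynomials by truncation. *)
Lemma coef_mul_trunc N (s t : series) n : (n < N)%N ->
  mul_series s t n = (trunc_series N s * trunc_series N t)`_n.
Proof.
move=> ltnN; rewrite coefM; apply: eq_bigr => i _; rewrite !coef_poly.
have := ltn_ord i; rewrite ltnS => lein.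
by rewrite (leq_ltn_trans lein ltnN) (leq_ltn_trans (leq_subr _ _) ltnN).
Qed.

Lemma coef_mul_trunc3 N (s t r : series) n : (n < N)%N ->
  mul_series (mul_series s t) r n =
  (trunc_series N s * trunc_series N t * trunc_series N r)`_n.
Proof.
move=> ltnN; rewrite coefM; apply: eq_bigr => i _.
have := ltn_ord i; rewrite ltnS => lein.
rewrite (coef_mul_trunc s t (leq_ltn_trans lein ltnN)) coef_poly.
by rewrite (leq_ltn_trans (leq_subr _ _) ltnN).
Qed.

Lemma mul_seriesC : commutative mul_series.
Proof.
by move=> s t; apply: seriesP => n; rewrite !(coef_mul_trunc _ _ (ltnSn n)) mulrC.
Qed.
Lemma mul_seriesA : associative mul_series.
Proof.
move=> s t r; apply: seriesP => n; rewrite mul_seriesC.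
by rewrite !(coef_mul_trunc3 _ _ _ (ltnSn n)); congr (nth 0 _ n); rewrite mulrC mulrA.
Qed.
Lemma mul_series1 : left_id (poly_series 1) mul_series.
Proof.
move=> s; apply: seriesP => n.
by rewrite /= big_ord_recl /= coef1 mul1r subn0 big1 ?addr0 // => i _; rewrite coef1 mul0r.
Qed.
Lemma mul_seriesDl : left_distributive mul_series add_series.
Proof.
move=> s t r; apply: seriesP => n.
by rewrite /= -big_split /=; apply: eq_bigr => i _; rewrite mulrDl.
Qed.
Lemma series1_neq0 : poly_series 1 != 0.
Proof. by apply/eqP => /(congr1 (fun s : series => s 0%N)) /=; rewrite coef1 coef0. Qed.

HB.instance Definition _ := GRing.Zmodule_isComNzRing.Build series
  mul_seriesA mul_seriesC mul_series1 mul_seriesDl series1_neq0.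

Lemma coef_sD (s t : series) n : (s + t) n = s n + t n. Proof. by []. Qed.
Lemma coef_sN (s : series) n : (- s) n = - s n. Proof. by []. Qed.
Lemma coef_sB (s t : series) n : (s - t) n = s n - t n. Proof. by []. Qed.
Lemma coef_sM (s t : series) n : (s * t) n = \sum_(i < n.+1) s i * t (n - i)%N.
Proof. by []. Qed.
Lemma coef_s0 n : (0 : series) n = 0. Proof. exact: coef0. Qed.
Lemma coef_s1 n : (1 : series) n = (n == 0%N)%:R. Proof. exact: coef1. Qed.
Lemma coef_sMn (s : series) k n : (s *+ k) n = s n *+ k.
Proof. by elim: k => [|k IH]; rewrite ?mulr0n ?coef_s0 // !mulrS coef_sD IH. Qed.

Lemma poly_series_is_zmod : zmod_morphism poly_series.
Proof. by move=> p r; apply: seriesP => n; rewrite coef_sB /= coefB. Qed.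
Lemma poly_series_is_monoid : monoid_morphism poly_series.
Proof. by split=> // p r; apply: seriesP => n; rewrite coef_sM /= coefM. Qed.
HB.instance Definition _ :=
  GRing.isZmodMorphism.Build {poly int} series poly_series poly_series_is_zmod.
HB.instance Definition _ :=
  GRing.isMonoidMorphism.Build {poly int} series poly_series poly_series_is_monoid.

Definition q : series := poly_series 'X.

Lemma coef_qXM k (s : series) n :
  (q ^+ k * s) n = if (n < k)%N then 0 else s (n - k)%N.
Proof.
have -> : (q ^+ k * s) n = ('X^k * trunc_series n.+1 s)`_n.
  rewrite -rmorphXn coef_sM coefM; apply: eq_bigr => i _.
  by rewrite coef_poly ltnS leq_subr.
by rewrite coefXnM coef_poly ltnS leq_subr.
Qed.

Lemma coef_q n : q n = (n == 1%N)%:R. Proof. exact: coefX. Qed.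
Lemma coef_qX k n : (q ^+ k) n = (n == k)%:R.
Proof. by rewrite -rmorphXn /= coefXn. Qed.

(** * Congruence of series modulo powers of [q] *)

Definition eqm M (s t : series) := forall n, (n < M)%N -> s n = t n.

Lemma eqm_refl M s : eqm M s s. Proof. by []. Qed.
Lemma eqm_sym M s t : eqm M s t -> eqm M t s.
Proof. by move=> st n ltnM; rewrite st. Qed.
Lemma eqm_trans M t s r : eqm M s t -> eqm M t r -> eqm M s r.
Proof. by move=> st tr n ltnM; rewrite st ?tr. Qed.
Lemma eqm_leq M N s t : (M <= N)%N -> eqm N s t -> eqm M s t.
Proof. by move=> leMN st n ltnM; apply: st; apply: leq_trans leMN. Qed.
Lemma eqmD M s s' t t' : eqm M s s' -> eqm M t t' -> eqm M (s + t) (s' + t').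
Proof. by move=> ss tt n ltnM; rewrite !coef_sD ss ?tt. Qed.
Lemma eqmN M s t : eqm M s t -> eqm M (- s) (- t).
Proof. by move=> st n ltnM; rewrite !coef_sN st. Qed.
Lemma eqmB M s s' t t' : eqm M s s' -> eqm M t t' -> eqm M (s - t) (s' - t').
Proof. by move=> ss tt; apply: eqmD => //; apply: eqmN. Qed.
Lemma eqmM M s s' t t' : eqm M s s' -> eqm M t t' -> eqm M (s * t) (s' * t').
Proof.
move=> ss tt n ltnM; rewrite !coef_sM; apply: eq_bigr => i _.
have := ltn_ord i; rewrite ltnS => lein.
by rewrite ss ?tt // ?(leq_ltn_trans lein ltnM) // (leq_ltn_trans (leq_subr _ _) ltnM).
Qed.
Lemma eqmMl M s t t' : eqm M t t' -> eqm M (s * t) (s * t').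
Proof. exact: eqmM. Qed.
Lemma eqmX M s t k : eqm M s t -> eqm M (s ^+ k) (t ^+ k).
Proof.
move=> st; elim: k => [|k IH]; first by rewrite !expr0.
by rewrite !exprS; apply: eqmM.
Qed.
Lemma eqm_sum M (I : Type) (r : seq I) (P : pred I) (F G : I -> series) :
  (forall i, P i -> eqm M (F i) (G i)) ->
  eqm M (\sum_(i <- r | P i) F i) (\sum_(i <- r | P i) G i).
Proof. by move=> FG; elim/big_ind2: _ => // *; apply: eqmD. Qed.
Lemma eqm_prod M (I : Type) (r : seq I) (P : pred I) (F G : I -> series) :
  (forall i, P i -> eqm M (F i) (G i)) ->
  eqm M (\prod_(i <- r | P i) F i) (\prod_(i <- r | P i) G i).
Proof. by move=> FG; elim/big_ind2: _ => // *; apply: eqmM. Qed.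
Lemma eqm_eq s t : (forall M, eqm M s t) -> s = t.
Proof. by move=> st; apply: seriesP => n; apply: (st n.+1). Qed.
Lemma eqm_qM M k s t : eqm M s t -> eqm (M + k) (q ^+ k * s) (q ^+ k * t).
Proof.
move=> st n ltn; rewrite !coef_qXM; case: ltnP => // lekn; apply: st.
by rewrite ltn_subLR // addnC.
Qed.
Lemma eqm_qX M k s : (M <= k)%N -> eqm M (q ^+ k * s) 0.
Proof.
by move=> leMk n ltnM; rewrite coef_qXM (leq_trans ltnM leMk) coef_s0.
Qed.

(** * Limits and inverses of series *)

(** The approximant [g M] is meant to be right below index [M], so [g n.+1] is the first one trusted
    at index [n]. *)
Definition lim_series (g : nat -> series) := Series (fun n => g n.+1 n).

Lemma lim_seriesP g : (forall M, eqm M (g M) (g M.+1)) ->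
  forall M N, (M <= N)%N -> eqm M (lim_series g) (g N).
Proof.
move=> gS M N leMN n ltnM /=.
have := leq_trans ltnM leMN => {leMN ltnM M}.
elim: N => // N IH; rewrite ltnS leq_eqVlt => /orP[/eqP <- //|ltnN].
by rewrite IH // gS.
Qed.

(** The geometric series in [1 - s]. It inverts [s] when the constant term is 1, for then
    [(1 - s) ^+ i] is divisible by [q ^+ i]. *)
Definition inv_series s := lim_series (fun M => \sum_(i < M) (1 - s) ^+ i).

Lemma eqm_1subX (s : series) k : s 0%N = 1 -> eqm k ((1 - s) ^+ k) 0.
Proof.
move=> s0; pose r := Series (fun n => (1 - s) n.+1).
have -> : 1 - s = q * r.
  apply: seriesP => n; rewrite -[q]expr1 coef_qXM.
  case: n => [|n]; first by rewrite coef_sB s0 coef_s1 subrr.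
  by rewrite subn1.
by rewrite exprMn; apply: eqm_qX.
Qed.

Lemma mulsV (s : series) : s 0%N = 1 -> s * inv_series s = 1.
Proof.
move=> s0; apply: eqm_eq => M.
have lim M' : eqm M' (\sum_(i < M') (1 - s) ^+ i) (\sum_(i < M'.+1) (1 - s) ^+ i).
  rewrite big_ord_recr /= -[X in eqm _ X _]addr0; apply: eqmD => //.
  exact/eqm_sym/eqm_1subX.
apply: eqm_trans (eqmMl s (lim_seriesP lim (leqnn M))) _.
have -> : s * (\sum_(i < M) (1 - s) ^+ i) = 1 - (1 - s) ^+ M.
  have := subrXX 1 (1 - s) M; rewrite expr1n subKr => ->; congr (_ * _).
  by apply: eq_bigr => i _; rewrite expr1n mul1r.
by rewrite -[X in eqm _ _ X]subr0; apply: eqmB => //; apply: eqm_1subX.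
Qed.

Lemma eqm_mulI M (s a b : series) : s 0%N = 1 -> eqm M (s * a) (s * b) -> eqm M a b.
Proof.
move=> /mulsV sV /(eqmMl (inv_series s)).
by rewrite !mulrA ![inv_series s * s]mulrC sV !mul1r.
Qed.
Lemma mulsI (s a b : series) : s 0%N = 1 -> s * a = s * b -> a = b.
Proof. by move=> s0 ab; apply: eqm_eq => M; apply: eqm_mulI s0 _; rewrite ab. Qed.

Lemma mulsnI k (s t : series) : s *+ k.+1 = t *+ k.+1 -> s = t.
Proof.
move=> st; apply: seriesP => n; apply/(@pmulrnI _ k.+1) => //.
by rewrite -!coef_sMn st.
Qed.

Lemma coef0M (s t : series) : (s * t) 0%N = s 0%N * t 0%N.
Proof. by rewrite coef_sM big_ord1. Qed.
Lemma coef0X (s : series) k : (s ^+ k) 0%N = s 0%N ^+ k.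
Proof. by elim: k => [|k IH]; rewrite ?expr0 ?coef_s1 // !exprS coef0M IH. Qed.
Lemma coef0V (s : series) : s 0%N = 1 -> inv_series s 0%N = 1.
Proof.
by move=> s0; have := congr1 (fun s : series => s 0%N) (mulsV s0); rewrite coef0M s0 mul1r coef_s1.
Qed.

(** * Trisection *)

(** [sub3 s] is s(q^3); [sect3 0] is the operator U. *)
Definition sub3 (s : series) :=
  Series (fun n => if (3 %| n)%N then s (n %/ 3)%N else 0).
Definition sect3 r (s : series) := Series (fun n => s (3 * n + r)%N).

Lemma sub3_is_zmod : zmod_morphism sub3.
Proof.
by move=> s t; apply: seriesP => n; rewrite coef_sB /=; case: ifP; rewrite ?subr0.
Qed.
(** Composition with ['X^3] is multiplicative on polynomials, and [sub3] agrees with it on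
    truncations. *)
Lemma sub3_is_monoid : monoid_morphism sub3.
Proof.
split=> [|s t]; apply: seriesP => n.
  by rewrite /= !coef1; case: n => [|[|[|n]]] //; case: ifP => //; lia.
have coefT (r : series) i : (i <= n)%N -> sub3 r i = (trunc_series n.+1 r \Po 'X^3)`_i.
  move=> lein; rewrite coef_comp_poly_Xn //= coef_poly ltnS.
  by rewrite (leq_trans (leq_div _ _) lein).
rewrite coefT // coef_sM.
transitivity (\sum_(i < n.+1) (trunc_series n.+1 s \Po 'X^3)`_i *
                              (trunc_series n.+1 t \Po 'X^3)`_(n - i)); last first.
  by apply: eq_bigr => i _; rewrite !coefT ?leq_subr // -ltnS.
rewrite -coefM -comp_polyM !coef_comp_poly_Xn //; case: ifP => // _.
have le := leq_div n 3; rewrite coef_poly ltnS le.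
by rewrite -coef_mul_trunc.
Qed.
HB.instance Definition _ :=
  GRing.isZmodMorphism.Build series series sub3 sub3_is_zmod.
HB.instance Definition _ :=
  GRing.isMonoidMorphism.Build series series sub3 sub3_is_monoid.

Lemma sub3_q : sub3 q = q ^+ 3.
Proof. by apply: seriesP => n; rewrite coef_qX /= !coefX; case: ifP; lia. Qed.

Lemma coef0_sub3 s : sub3 s 0%N = s 0%N. Proof. by []. Qed.

Lemma eqm_sub3 M s t : eqm M s t -> eqm M (sub3 s) (sub3 t).
Proof.
by move=> st n ltnM /=; case: ifP => // _; apply: st; apply: leq_ltn_trans ltnM; apply: leq_div.
Qed.
Lemma eqm_sect3 M r s t : (r < 3)%N -> eqm (3 * M) s t -> eqm M (sect3 r s) (sect3 r t).
Proof. by move=> r3 st n ltnM /=; apply: st; lia. Qed.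

Lemma sect3_is_zmod r : zmod_morphism (sect3 r).
Proof. by move=> s t; apply: seriesP. Qed.
HB.instance Definition _ r :=
  GRing.isZmodMorphism.Build series series (sect3 r) (sect3_is_zmod r).

Lemma sect3_qX r k s : (r < 3)%N -> (k < 3)%N ->
  sect3 r (q ^+ k * sub3 s) = if r == k then s else 0.
Proof.
move=> r3 k3; apply: seriesP => n.
change ((q ^+ k * sub3 s) (3 * n + r)%N = (if r == k then s else 0) n); rewrite coef_qXM /=.
case: ifP => [ltk|/negbT]; first by case: eqP => [|_]; [lia | rewrite coef_s0].
rewrite -leqNgt => gek; case: eqP => [<-|rk].
  by rewrite addnK dvdn_mulr // mulKn.
by rewrite coef_s0; case: ifP => //; lia.
Qed.

Definition join3 a b c := sub3 a + q * sub3 b + q ^+ 2 * sub3 c.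

Lemma join3K s : join3 (sect3 0 s) (sect3 1 s) (sect3 2 s) = s.
Proof.
apply: seriesP => n; rewrite !coef_sD -[q in q * _]expr1 !coef_qXM.
have off t i : ~~ (3 %| i)%N -> sub3 t i = 0 by move=> /negbTE /= ->.
have on t i : sub3 t (3 * i) = t i by rewrite /= dvdn_mulr // mulKn.
rewrite (divn_eq n 3) mulnC; move: (n %/ 3)%N (ltn_pmod n (isT : 0 < 3)%N) => m.
case: (n %% 3)%N => [|[|[|//]]] _.
- rewrite addn0 on; case: m => [|m]; first by rewrite /= !addr0.
  by rewrite !ifN ?off ?addr0 //=; [rewrite addn0 | lia..].
- rewrite addnK on off ?add0r; last lia.
  by rewrite ifN; [case: ltnP => [//|ge2]; rewrite ?off ?addr0 //; lia | lia].
rewrite !ifN ?addnK ?on ?off ?add0r //; lia.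
Qed.

Lemma sect3_join3 a b c :
  [/\ sect3 0 (join3 a b c) = a, sect3 1 (join3 a b c) = b & sect3 2 (join3 a b c) = c].
Proof.
have qE : q = q ^+ 1 by [].
have -> : join3 a b c = q ^+ 0 * sub3 a + q ^+ 1 * sub3 b + q ^+ 2 * sub3 c.
  by rewrite mul1r.
by split; rewrite !raddfD /= !sect3_qX //= ?addr0 ?add0r.
Qed.

Lemma join3M a b c a' b' c' :
  join3 a b c * join3 a' b' c' =
  join3 (a * a' + q * (b * c' + c * b')) (a * b' + b * a' + q * (c * c'))
        (a * c' + b * b' + c * a').
Proof.
rewrite /join3 !(rmorphD, rmorphM) /= sub3_q.
move: q (sub3 a) (sub3 b) (sub3 c) (sub3 a') (sub3 b') (sub3 c') => u a0 b0 c0 a1 b1 c1.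
ring.
Qed.

(** A series in q^3 has only a zeroth part, so it acts as a scalar. This turns the cubic equation
    into a recurrence for U. *)
Lemma sect3_sub3M r (s t : series) : (r < 3)%N -> sect3 r (sub3 s * t) = s * sect3 r t.
Proof.
have -> : sub3 s = join3 s 0 0 by rewrite /join3 !rmorph0 !mulr0 !addr0.
rewrite -{1}(join3K t) join3M !(mul0r, mulr0, addr0).
have [e0 e1 e2] := sect3_join3 (s * sect3 0 t) (s * sect3 1 t) (s * sect3 2 t).
by case: r => [|[|[|r]]].
Qed.

Definition norm3 s :=
  sect3 0 s ^+ 3 + q * sect3 1 s ^+ 3 + q ^+ 2 * sect3 2 s ^+ 3
  - 3 * (q * sect3 0 s * sect3 1 s * sect3 2 s).

Lemma norm3_join3 a b c :
  norm3 (join3 a b c) = a ^+ 3 + q * b ^+ 3 + q ^+ 2 * c ^+ 3 - 3 * (q * a * b * c).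
Proof. by rewrite /norm3; have [-> -> ->] := sect3_join3 a b c. Qed.

(* [norm3] is the product of the three series s(w^i q), w^3 = 1, read in q^3. *)
Lemma norm3M (s t : series) : norm3 (s * t) = norm3 s * norm3 t.
Proof.
rewrite -{1}(join3K s) -{1}(join3K t) join3M norm3_join3 /norm3.
move: q (sect3 0 s) (sect3 1 s) (sect3 2 s) (sect3 0 t) (sect3 1 t) (sect3 2 t).
by move=> u a b c a' b' c'; ring.
Qed.

Lemma eqm_norm3 M s t : eqm (3 * M) s t -> eqm M (norm3 s) (norm3 t).
Proof.
by move=> st; have e r (r3 : (r < 3)%N) := eqm_sect3 r3 st;
  repeat first [apply: eqmB | apply: eqmD | apply: eqmM | apply: eqmX | exact: e].
Qed.

(** * The Jacobi triple product *)

Section JacobiTriple.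
Variables (R : comPzRingType) (p x y : R).

Fixpoint qbinom (n k : nat) : R :=
  match k, n with
  | 0, _ => 1
  | _.+1, 0 => 0
  | k'.+1, n'.+1 => qbinom n' k + p ^+ (n' - k') * qbinom n' k'
  end.

Lemma qbinom0 n : qbinom n 0 = 1. Proof. by case: n. Qed.
Lemma qbinomS n k :
  qbinom n.+1 k.+1 = qbinom n k.+1 + p ^+ (n - k) * qbinom n k.
Proof. by []. Qed.
Lemma qbinom_small n k : (n < k)%N -> qbinom n k = 0.
Proof.
elim: n k => [|n IH] [|k] //; rewrite ltnS => ltnk.
by rewrite qbinomS !IH ?mulr0 ?addr0 // ltnW.
Qed.
Lemma qbinomnn n : qbinom n n = 1.
Proof.
by elim: n => // n IH; rewrite qbinomS qbinom_small // subnn IH add0r mul1r.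
Qed.
(** The mirror Pascal rule. [qbinomS] serves to add a factor to the [x] product, this one to the [y]
    product. *)
Lemma qbinomS' n k :
  qbinom n.+1 k.+1 = p ^+ k.+1 * qbinom n k.+1 + qbinom n k.
Proof.
elim: n k => [|n IH] k.
  by case: k => [|k]; rewrite qbinomS ?qbinom0 /= ?mulr0 ?mulr1 ?add0r.
have [ltnk|] := ltnP n k.
  rewrite qbinomS (@qbinom_small _ k.+1) // mulr0 !add0r.
  have -> : (n.+1 - k = 0)%N by lia.
  by rewrite mul1r.
case: k => [|k] lekn.
  by rewrite qbinomS {1}IH qbinomS !qbinom0 !subn0 [p ^+ n.+1]exprS; ring.
rewrite qbinomS {1}IH {1}IH [qbinom n.+1 k.+2]qbinomS [qbinom n.+1 k.+1]qbinomS.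
have -> : (n.+1 - k.+1 = n - k)%N by [].
have -> : (n - k = (n - k.+1).+1)%N by lia.
by rewrite !exprS; ring.
Qed.

Arguments qbinom : simpl never.

Definition qfact n : R := \prod_(i < n) (1 - p ^+ i.+1).

Lemma qfactS n : qfact n.+1 = qfact n * (1 - p ^+ n.+1).
Proof. exact: big_ord_recr. Qed.

Lemma qbinom_fact n k : (k <= n)%N -> qbinom n k * qfact k * qfact (n - k) = qfact n.
Proof.
elim: n k => [|n IH] [|k] lekn.
- by rewrite /qfact !big_ord0 !mulr1.
- by [].
- by rewrite qbinom0 subn0 /qfact big_ord0 !mul1r.
move: lekn; rewrite ltnS leq_eqVlt => /orP[/eqP ->|ltkn].
  by rewrite qbinomnn subnn /qfact big_ord0 mul1r mulr1.
have nkE : (n - k = (n - k.+1).+1)%N by lia.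
have := IH _ ltkn; have := IH _ (ltnW ltkn).
rewrite qbinomS subSS nkE !qfactS.
have -> : p ^+ n.+1 = p ^+ k.+1 * p ^+ (n - k.+1).+1.
  by rewrite -exprD; congr (_ ^+ _); lia.
move=> e1 e2.
set A := qbinom n k.+1 in e2 *; set B := qbinom n k in e1 *.
set P := p ^+ k.+1 in e1 e2 *; set Q := p ^+ _ in e1 e2 *.
set F := qfact k in e1 e2 *; set G := qfact _ in e1 e2 *.
(* The two terms of Pascal's rule match the split 1 - P Q = (1 - Q) + Q (1 - P). *)
transitivity (A * (F * (1 - P)) * G * (1 - Q) + Q * (1 - P) * (B * F * (G * (1 - Q)))).
  by ring.
by rewrite e1 e2; ring.
Qed.

(* [theta_term N k] is x^(m(m+1)/2) y^(m(m-1)/2) at the integer m = k - N. *)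
Definition theta_term N k : R :=
  if (N <= k)%N then x ^+ 'C((k - N).+1, 2) * y ^+ 'C(k - N, 2)
  else x ^+ 'C(N - k, 2) * y ^+ 'C((N - k).+1, 2).

Lemma theta_termSS N k : theta_term N.+1 k.+1 = theta_term N k.
Proof. by []. Qed.
Lemma theta_termDl N m : theta_term N (N + m) = x ^+ 'C(m.+1, 2) * y ^+ 'C(m, 2).
Proof. by rewrite /theta_term leq_addr addKn. Qed.
Lemma theta_termDr k m : theta_term (k + m) k = x ^+ 'C(m, 2) * y ^+ 'C(m.+1, 2).
Proof.
case: m => [|m].
  by have := theta_termDl k 0; rewrite addn0 => ->; rewrite !bin_small // !expr0.
by rewrite /theta_term leqNgt -addSnnS leq_addr /= addSnnS addKn.
Qed.

Hypothesis pE : p = x * y.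

Lemma pX j : p ^+ j = x ^+ j * y ^+ j.
Proof. by rewrite pE exprMn. Qed.

(** Since ['C(m.+1, 2) = 'C(m, 2) + m], the new factor of the [x] product moves a term one index up
    and leaves the power of [p] found in [qbinomS]. *)
Lemma theta_term_up M N k : (k <= M + N)%N ->
  theta_term N k * (x * p ^+ M) = p ^+ (M + N - k) * theta_term N k.+1.
Proof.
have [/subnKC <-|] := leqP N k.
  move: (k - N)%N => m lem; have ->: (M + N - (N + m) = M - m)%N by lia.
  rewrite -addnS !theta_termDl [in RHS]binS [in X in _ = _ * (_ * X)]binS !bin1.
  have {1}-> : (M = (M - m) + m)%N by lia.
  rewrite [p ^+ (_ + m)]exprD [p ^+ m]pX !exprD exprS.
  set P := p ^+ _; move: P (x ^+ m) (y ^+ m) (x ^+ 'C(_, _)) (y ^+ 'C(_, _)).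
  by move=> P a b c d; ring.
move=> /subnKC; move: (N - k.+1)%N => m <- _.
rewrite {1}addSnnS theta_termDr theta_termDr.
have -> : (M + (k.+1 + m) - k = M + m.+1)%N by lia.
rewrite [in LHS]binS [in X in _ * X * _ = _]binS !bin1.
rewrite [p ^+ (_ + m.+1)]exprD [p ^+ m.+1]pX !exprD [x ^+ m.+1]exprS.
move: (p ^+ M) (x ^+ m) (y ^+ m.+1) (x ^+ 'C(_, _)) (y ^+ 'C(_, _)).
by move=> P a b c d; ring.
Qed.

(** The counterpart for the [y] product: one index down, with the power of [p] found in
    [qbinomS']. *)
Lemma theta_term_down N k :
  theta_term N k * (y * p ^+ N) = p ^+ k * theta_term N.+1 k.
Proof.
have [/subnKC <-|/ltnW /subnKC] := leqP N k.
  case: (k - N)%N => [|m].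
    have := theta_termDr N 1; have := theta_termDl N 0; rewrite addn0 addn1 => -> ->.
    by rewrite binn !bin_small //; ring.
  rewrite -{3}addSnnS !theta_termDl [in LHS]binS [in X in _ * X * _ = _]binS !bin1.
  rewrite [p ^+ (_ + _)]exprD [p ^+ m.+1]pX !exprD [y ^+ m.+1]exprS.
  move: (p ^+ N) (x ^+ m.+1) (y ^+ m) (x ^+ 'C(_, _)) (y ^+ 'C(_, _)).
  by move=> P a b c d; ring.
move: (N - k)%N => m <-; rewrite -addnS !theta_termDr.
rewrite [in RHS]binS [in X in _ = _ * (_ * X)]binS !bin1.
rewrite [p ^+ (_ + _)]exprD [p ^+ m]pX !exprD exprS.
move: (p ^+ k) (x ^+ m) (y ^+ m) (x ^+ 'C(_, _)) (y ^+ 'C(_, _)).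
by move=> P a b c d; ring.
Qed.

(** The finite triple product. Induction on [M], with an induction on [N] for the case [M = 0]; each
    new factor is absorbed by a Pascal rule. *)
Lemma jacobi_finite M N :
  (\prod_(i < M) (1 + x * p ^+ i)) * (\prod_(i < N) (1 + y * p ^+ i)) =
  \sum_(k < (M + N).+1) qbinom (M + N) k * theta_term N k.
Proof.
elim: M => [|M IH].
  rewrite big_ord0 mul1r add0n; elim: N => [|N IH].
    by rewrite big_ord0 big_ord1 qbinom0 mul1r (theta_termDl 0 0) !bin_small // mulr1.
  have -> : \sum_(k < N.+2) qbinom N.+1 k * theta_term N.+1 k =
    \sum_(k < N.+1) qbinom N k * theta_term N k +
    \sum_(k < N.+2) qbinom N k * (p ^+ k * theta_term N.+1 k).
    rewrite big_ord_recl [X in _ = _ + X]big_ord_recl /= !qbinom0 expr0 !mul1r.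
    rewrite addrCA -big_split; congr (_ + _); apply: eq_bigr => k _.
    rewrite /bump add1n qbinomS' theta_termSS /=.
    by move: (qbinom _ _) (qbinom _ _) (p ^+ _) (theta_term _ _) => a b c d; ring.
  rewrite big_ord_recr /= IH mulrDr mulr1 mulr_suml.
  rewrite [X in _ = _ + X]big_ord_recr /= (@qbinom_small _ N.+1) // mul0r addr0.
  congr (_ + _); apply: eq_bigr => k _.
  by rewrite -theta_term_down -mulrA.
have -> : \sum_(k < (M.+1 + N).+1) qbinom (M.+1 + N) k * theta_term N k =
    \sum_(k < (M + N).+2) qbinom (M + N) k * theta_term N k +
    \sum_(k < (M + N).+1) qbinom (M + N) k * (p ^+ (M + N - k) * theta_term N k.+1).
  rewrite addSn big_ord_recl [X in _ = X + _]big_ord_recl /= !qbinom0.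
  rewrite -addrA -big_split; congr (_ + _); apply: eq_bigr => k _.
  rewrite /bump add1n qbinomS /=.
  by move: (qbinom _ _) (qbinom _ _) (p ^+ _) (theta_term _ _) => a b c d; ring.
rewrite big_ord_recr /= mulrAC IH mulrDr mulr1 mulr_suml.
rewrite [X in _ = X + _]big_ord_recr /= qbinom_small // mul0r addr0.
congr (_ + _); apply: eq_bigr => k _.
by rewrite -theta_term_up -?mulrA // -ltnS.
Qed.

(* The theta terms with indices -M, ..., M. *)
Definition theta_sum M : R := 1 + \sum_(m < M)
  (x ^+ 'C(m.+2, 2) * y ^+ 'C(m.+1, 2) + x ^+ 'C(m.+1, 2) * y ^+ 'C(m.+2, 2)).

Lemma sum_centered (G : nat -> R) M :
  \sum_(k < (M + M).+1) G k =
  G M + \sum_(m < M) (G (M + m.+1)%N + G (M - m.+1)%N).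
Proof.
elim: M G => [|M IH] G; first by rewrite big_ord1 big_ord0 addr0.
rewrite big_ord_recl addSn addnS big_ord_recr /=.
rewrite (eq_bigr (fun k : 'I__ => G k.+1)) // (IH (fun k => G k.+1)) [in RHS]big_ord_recr /= subnn.
rewrite addnS /bump /=; set a := G _; set b := G _; set c := \sum_(_ < _) _.
set d := \sum_(_ < _) _; have -> : d = c.
  apply: eq_bigr => m _; have ltmM := ltn_ord m; congr (G _ + G _); lia.
by rewrite add1n; ring.
Qed.

End JacobiTriple.

Section JacobiTripleSeries.
Variables (x y0 : series).
(** The factor [q] makes [p] divisible by [q], so products in powers of [p] converge, while [x] may
    still be 1 as it is for [psi]. *)
Let y := q * y0.
Let p := x * y.

Lemma eqm_powp M k : (M <= k)%N -> eqm M (p ^+ k) 0.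
Proof.
by move=> leMk; rewrite /p /y mulrCA exprMn; apply: eqm_qX.
Qed.

Lemma qfact_coef0 n : (qfact p n : series) 0%N = 1.
Proof.
elim: n => [|n IH]; first by rewrite /qfact big_ord0 coef_s1.
rewrite qfactS coef0M IH mul1r coef_sB coef_s1 /=.
by rewrite (@eqm_powp 1 n.+1) // coef_s0 subr0.
Qed.

Lemma qfact_eqm L n : (L <= n)%N -> eqm L.+1 (qfact p n) (qfact p L).
Proof.
move=> /subnKC <-; elim: (n - L)%N => [|d IH]; first by rewrite addn0.
rewrite addnS qfactS; apply: eqm_trans IH.
rewrite -[X in eqm _ _ X]mulr1; apply: eqmMl; rewrite -[X in eqm _ _ X]subr0.
by apply: eqmB => //; apply: eqm_powp; rewrite ltnS leq_addr.
Qed.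

(** As [k] and [n - k] grow, the Gaussian binomial tends to the inverse of (p; p)_infinity: in
    [qbinom_fact] all three factorials then agree with [qfact p L]. *)
Lemma qbinom_eqm L n k : (L <= k)%N -> (L + k <= n)%N ->
  eqm L.+1 (qbinom p n k * qfact p L) 1.
Proof.
move=> leLk leLkn; apply: (@eqm_mulI _ (qfact p L)); first exact: qfact_coef0.
have e := @qbinom_fact _ p n k (leq_trans (leq_addl _ _) leLkn).
have le1 : (L <= n - k)%N by lia.
have le2 : (L <= n)%N := leq_trans (leq_addr _ _) leLkn.
rewrite mulr1; apply: eqm_trans (qfact_eqm le2); rewrite -e.
rewrite mulrC; apply: eqmM; last exact/eqm_sym/qfact_eqm.
by apply: eqmMl; apply/eqm_sym/qfact_eqm.
Qed.

Lemma jacobi_triple M :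
  eqm M (\prod_(i < M) ((1 + x * p ^+ i) * (1 + y * p ^+ i) * (1 - p ^+ i.+1)))
        (theta_sum x y M).
Proof.
rewrite 2!big_split /= (jacobi_finite (erefl p)) -/(qfact p M) mulr_suml.
rewrite (sum_centered (fun k => qbinom p (M + M) k * theta_term x y M k * qfact p M)).
have le_bin m : (m <= 'C(m.+1, 2))%N by rewrite binS bin1 leq_addl.
(* Far from the centre the binomial is accurate only up to index [L], but the term carries [q ^+ e],
   and [L.+1 + e] still reaches [M]. *)
have key L k e (t : series) : (L <= M)%N -> (L <= k)%N -> (L + k <= M + M)%N ->
    (M <= L.+1 + e)%N ->
    eqm M (qbinom p (M + M) k * (q ^+ e * t) * qfact p M) (q ^+ e * t).
  move=> leLM leLk leLkM leM; apply: eqm_leq leM _.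
  rewrite mulrAC mulrC -mulrA -[X in eqm _ _ X]mulr1 -mulrA; apply: eqm_qM.
  apply: eqmMl.
  apply: eqm_trans (qbinom_eqm leLk leLkM); apply: eqmMl; exact: qfact_eqm.
have yX j : y ^+ j = q ^+ j * y0 ^+ j by rewrite exprMn.
rewrite /theta_sum; apply: eqmD.
  have := theta_termDl x y M 0; rewrite addn0 => ->; rewrite !bin_small // mulr1.
  by have := key M M 0%N 1; rewrite mulr1 !expr0; apply; lia.
apply: eqm_sum => m _; have ltmM := ltn_ord m.
apply: eqmD.
  rewrite theta_termDl yX [x ^+ _ * _]mulrCA; apply: (key (M - m.+1)%N); try lia.
  by have := le_bin m; lia.
have := theta_termDr x y (M - m.+1) m.+1; rewrite subnK // => ->.
rewrite yX [x ^+ _ * _]mulrCA; apply: (key (M - m.+1)%N); try lia.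
by have := le_bin m.+1; lia.
Qed.

End JacobiTripleSeries.

(** * Euler products and theta quotients *)

(** The new factors are written through [z ^+ M], so that in the inductions on [M] below [ring] can
    treat q^M as one variable. *)
Lemma qfact_stride (R : comPzRingType) (z : R) d M :
  qfact z (d * M.+1) = qfact z (d * M) * \prod_(j < d) (1 - (z ^+ M) ^+ d * z ^+ j.+1).
Proof.
rewrite /qfact mulnS addnC big_split_ord /=; congr (_ * _).
by apply: eq_bigr => j _; rewrite -addnS exprD mulnC exprM.
Qed.

HB.lock Definition euler k := lim_series (qfact (q ^+ k)).

(** Gives [q ^+ k] the shape [x * (q * y0)] with [x = 1], under which the [qfact] lemmas of the
    triple product apply. *)
Lemma qXE k : (0 < k)%N -> q ^+ k = 1 * (q * q ^+ k.-1).
Proof. by case: k => // k _; rewrite mul1r exprS. Qed.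

Lemma euler_eqm k M N : (0 < k)%N -> (M <= N)%N -> eqm M (euler k) (qfact (q ^+ k) N).
Proof.
rewrite euler.unlock => k0; apply: lim_seriesP => L; apply: (@eqm_leq L L.+1) => //.
by rewrite (qXE k0); apply/eqm_sym/qfact_eqm.
Qed.

Lemma coef0_euler k : (0 < k)%N -> euler k 0%N = 1.
Proof.
by move=> k0; rewrite (@euler_eqm k 1 1) // (qXE k0) qfact_coef0.
Qed.

Lemma sub3_qfact k M : sub3 (qfact (q ^+ k) M) = qfact (q ^+ (3 * k)) M.
Proof.
rewrite rmorph_prod; apply: eq_bigr => i _.
by rewrite rmorphB rmorph1 !rmorphXn /= sub3_q -!exprM ?mulnA.
Qed.

Lemma sub3_euler k : (0 < k)%N -> sub3 (euler k) = euler (3 * k).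
Proof.
move=> k0; apply: eqm_eq => M.
apply: eqm_trans (eqm_sub3 (euler_eqm k0 (leqnn M))) _.
by rewrite sub3_qfact; apply/eqm_sym/euler_eqm; rewrite ?muln_gt0.
Qed.

(** * Norms of Euler products *)

(** The exponent is a multiple of 3, so the three conjugates coincide. *)
Lemma norm3_q3 k m : norm3 (1 - q ^+ (k * (3 * m).+3)) = (1 - q ^+ (k * m.+1)) ^+ 3.
Proof.
have -> : 1 - q ^+ (k * (3 * m).+3) = join3 (1 - q ^+ (k * m.+1)) 0 0.
  rewrite /join3 !rmorph0 !mulr0 !addr0 rmorphB rmorph1 rmorphXn /= sub3_q -exprM.
  by congr (1 - q ^+ _); lia.
by rewrite norm3_join3; ring.
Qed.

(** The conjugates 1 - w^(ik) q^k multiply to 1 - q^(3k), which read in q^3 is the original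
    factor. *)
Lemma norm3_qn3 k : ~~ (3 %| k)%N -> norm3 (1 - q ^+ k) = 1 - q ^+ k.
Proof.
move=> k3; have kE : k = (3 * (k %/ 3) + k %% 3)%N by lia.
have sX : sub3 (q ^+ (k %/ 3)) = q ^+ (3 * (k %/ 3)) by rewrite rmorphXn /= sub3_q -exprM.
have [r1|r2] : (k %% 3 = 1 \/ k %% 3 = 2)%N by lia.
  have E : 1 - q ^+ k = join3 1 (- q ^+ (k %/ 3)) 0.
    by rewrite /join3 rmorph1 rmorph0 rmorphN /= sX [X in 1 - q ^+ X]kE r1 exprD expr1; ring.
  rewrite {1}E norm3_join3 [X in _ = 1 - q ^+ X]kE r1 exprD expr1 mulnC exprM.
  by move: (q ^+ _) => u; ring.
have E : 1 - q ^+ k = join3 1 0 (- q ^+ (k %/ 3)).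
  by rewrite /join3 rmorph1 rmorph0 rmorphN /= sX [X in 1 - q ^+ X]kE r2 exprD; ring.
rewrite {1}E norm3_join3 [X in _ = 1 - q ^+ X]kE r2 exprD mulnC exprM.
by move: (q ^+ (k %/ 3)) => u; ring.
Qed.

Lemma norm3_1 : norm3 1 = 1.
Proof.
have E : 1 = join3 1 0 0 by rewrite /join3 rmorph1 rmorph0; ring.
by rewrite {1}E norm3_join3; ring.
Qed.

(** Factors with index prime to 3 contribute f_k / f_(3k), those with index divisible by 3
    contribute f_k^3. *)
Lemma norm3_euler k : (0 < k)%N -> ~~ (3 %| k)%N ->
  norm3 (euler k) * euler (3 * k) = euler k ^+ 4.
Proof.
move=> k0 k3.
have fin M : norm3 (qfact (q ^+ k) (3 * M)) * qfact (q ^+ (3 * k)) M =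
             qfact (q ^+ k) (3 * M) * qfact (q ^+ k) M ^+ 3.
  elim: M => [|M IH].
    by rewrite muln0 /qfact !big_ord0 norm3_1; ring.
  have -> : (3 * M.+1 = (3 * M).+3)%N by lia.
  rewrite !qfactS !norm3M -!exprM norm3_q3 !norm3_qn3; try lia.
  have -> : (3 * k * M.+1 = k * (3 * M).+3)%N by lia.
  set a := norm3 _ in IH *; set b := qfact (q ^+ (3 * k)) M in IH *.
  set c := qfact _ _ in IH *; set d := qfact _ M in IH *.
  set u := q ^+ _; set v := q ^+ _; set w := q ^+ _; set t := q ^+ _.
  transitivity ((a * b) * (1 - u) * (1 - v) * (1 - t) * (1 - w) ^+ 3); first by ring.
  by rewrite IH; ring.
apply: eqm_eq => M; have leM : (M <= 3 * M)%N by lia.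
have k3_gt0 : (0 < 3 * k)%N by lia.
apply: eqm_trans (eqmM (eqm_norm3 (euler_eqm k0 (leqnn _))) (euler_eqm k3_gt0 (leqnn M))) _.
rewrite fin [_ ^+ 4]exprS; apply: eqm_sym; apply: eqmM; last apply: eqmX; exact: euler_eqm.
Qed.

(** Reduces a product formula with quotient d / n to an exact identity between finite approximants,
    which is then proved by induction on [M]. *)
Lemma mulrV_eqm M (g n d n' d' : series) : n 0%N = 1 -> eqm M n n' -> eqm M d d' ->
  g * n' = d' -> eqm M g (d * inv_series n).
Proof.
move=> n0 nn dd gE; apply: (eqm_mulI n0); rewrite mulrCA mulsV // mulr1.
by apply: eqm_trans (eqm_sym dd); rewrite -gE mulrC; apply: eqmMl.
Qed.

(* In Ramanujan's notation f(a, b) for the theta series, [phi] is f(-q, -q) = phi(-q),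
   [psi] is f(q, q^3) = f(1, q) / 2, [theta_A] is f(q, q^2) and [theta_O] is
   f(-q, -q^5).  Locking keeps unification from unfolding the quotients. *)
HB.lock Definition phi := euler 1 ^+ 2 * inv_series (euler 2).
HB.lock Definition psi := euler 2 ^+ 2 * inv_series (euler 1).
HB.lock Definition theta_A := euler 2 * euler 3 ^+ 2 * inv_series (euler 1 * euler 6).
HB.lock Definition theta_O := euler 1 * euler 6 ^+ 2 * inv_series (euler 2 * euler 3).

(** * Product formulas of the four theta series *)

Lemma expr_stride k M : (q ^+ k) ^+ M = (q ^+ M) ^+ k.
Proof. exact: exprAC. Qed.

(** The triple product contains the odd factors 1 - q^(2i+1) twice and the even ones once;
    multiplying by f_2 completes f_1^2. *)
Lemma theta_phi M : eqm M (theta_sum (- q) (q * -1) M) phi.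
Proof.
apply: eqm_trans (eqm_sym (@jacobi_triple (- q) (- 1) M)) _.
rewrite phi.unlock; have -> : - q * (q * -1) = q ^+ 2 by ring.
apply: (@mulrV_eqm _ _ _ _ (qfact (q ^+ 2) M) (qfact (q ^+ 1) (2 * M) ^+ 2)).
- exact: coef0_euler.
- exact: euler_eqm.
- by apply: eqmX; apply: euler_eqm => //; lia.
elim: M => [|M IH]; first by rewrite /qfact !big_ord0; ring.
rewrite big_ord_recr /= qfact_stride qfactS !big_ord_recl big_ord0 /bump /=.
rewrite !(exprS _ M) !expr1 !(expr_stride _ M) in IH *.
set A := \prod_(_ < _) _ in IH *; set B := qfact _ M in IH *.
set C := qfact _ _ in IH *; move: A B C q (q ^+ M) IH => A B C u w IH.
transitivity (A * B * ((1 - u * w ^+ 2) * (1 - u ^+ 2 * w ^+ 2)) ^+ 2); first by ring.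
by rewrite IH; ring.
Qed.

Lemma theta_psi M : eqm M (theta_sum 1 (q * 1) M) (psi *+ 2).
Proof.
apply: eqm_trans (eqm_sym (@jacobi_triple 1 1 M)) _.
have -> : 1 * (q * 1) = q by ring.
rewrite psi.unlock -mulrnAl.
(* The factors 1 + q^i run over i < M, the case i = 0 giving the 2. The extra [1 + q ^+ M], which is
   1 modulo q^M, restores the range 1, ..., M. *)
apply: (@mulrV_eqm _ _ _ _ ((1 + q ^+ M) * qfact (q ^+ 1) M) (qfact (q ^+ 2) M ^+ 2 *+ 2)).
- exact: coef0_euler.
- rewrite -[X in eqm _ X _]mul1r; apply: eqmM; last exact: euler_eqm.
  rewrite -[X in eqm _ X _]addr0; apply: eqmD => //; apply: eqm_sym.
  by rewrite -[q ^+ M]mulr1; apply: eqm_qX.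
- by rewrite !mulr2n; apply: eqmD; apply: eqmX; apply: euler_eqm.
elim: M => [|M IH]; first by rewrite /qfact !big_ord0; ring.
rewrite big_ord_recr /= !qfactS.
rewrite !(exprS _ M) !expr1 !(expr_stride _ M) in IH *.
set A := \prod_(_ < _) _ in IH *; set B := qfact _ M in IH *.
set C := qfact _ _ in IH *; move: A B C q (q ^+ M) IH => A B C u w IH.
transitivity (A * ((1 + w) * B) * (1 - u ^+ 2 * w ^+ 2) ^+ 2); first by ring.
by rewrite IH; ring.
Qed.

(** Multiplying by f_1 turns each 1 + q^j with j prime to 3 into 1 - q^(2j), and f_6 supplies the
    remaining factors of f_2. *)
Lemma theta_theta_A M : eqm M (theta_sum q (q * q) M) theta_A.
Proof.
apply: eqm_trans (eqm_sym (@jacobi_triple q q M)) _.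
rewrite theta_A.unlock; have -> : q * (q * q) = q ^+ 3 by ring.
apply: (@mulrV_eqm _ _ _ _ (qfact (q ^+ 1) (3 * M) * qfact (q ^+ 6) M)
  (qfact (q ^+ 2) (3 * M) * qfact (q ^+ 3) M ^+ 2)).
- by rewrite coef0M !coef0_euler.
- by apply: eqmM; apply: euler_eqm => //; lia.
- by apply: eqmM; first (apply: euler_eqm => //; lia); apply: eqmX; apply: euler_eqm.
elim: M => [|M IH]; first by rewrite /qfact !big_ord0; ring.
rewrite big_ord_recr /= !qfact_stride !qfactS !big_ord_recl !big_ord0 /bump /=.
rewrite !(exprS _ M) !expr1 !(expr_stride _ M) in IH *.
set A := \prod_(_ < _) _ in IH *; set B := qfact q _ in IH *.
set C := qfact (q ^+ 6) _ in IH *; set D := qfact (q ^+ 2) _ in IH *.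
set E := qfact (q ^+ 3) _ in IH *.
move: A B C D E q (q ^+ M) IH => A B C D E u w IH.
transitivity (A * (B * C) * ((1 - u ^+ 2 * w ^+ 6) * (1 - u ^+ 4 * w ^+ 6) *
  (1 - u ^+ 6 * w ^+ 6) * (1 - u ^+ 3 * w ^+ 3) ^+ 2)); first by ring.
by rewrite IH; ring.
Qed.

(** The indices congruent to 1 or 5 modulo 6 are what inclusion-exclusion over multiples of 2 and 3
    leaves of f_1: the quotient f_1 f_6 / (f_2 f_3). *)
Lemma theta_theta_O M : eqm M (theta_sum (- q) (q * (- q ^+ 4)) M) theta_O.
Proof.
apply: eqm_trans (eqm_sym (@jacobi_triple (- q) (- q ^+ 4) M)) _.
rewrite theta_O.unlock; have -> : - q * (q * (- q ^+ 4)) = q ^+ 6 by ring.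
apply: (@mulrV_eqm _ _ _ _ (qfact (q ^+ 2) (3 * M) * qfact (q ^+ 3) (2 * M))
  (qfact (q ^+ 1) (6 * M) * qfact (q ^+ 6) M ^+ 2)).
- by rewrite coef0M !coef0_euler.
- by apply: eqmM; apply: euler_eqm => //; lia.
- by apply: eqmM; first (apply: euler_eqm => //; lia); apply: eqmX; apply: euler_eqm.
elim: M => [|M IH]; first by rewrite /qfact !big_ord0; ring.
rewrite big_ord_recr /= !qfact_stride !qfactS !big_ord_recl !big_ord0 /bump /=.
rewrite !(exprS _ M) !expr1 !(expr_stride _ M) in IH *.
set A := \prod_(_ < _) _ in IH *; set B := qfact q _ in IH *.
set C := qfact (q ^+ 6) _ in IH *; set D := qfact (q ^+ 2) _ in IH *.
set E := qfact (q ^+ 3) _ in IH *.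
move: A B C D E q (q ^+ M) IH => A B C D E u w IH.
transitivity (A * (D * E) * ((1 - u * w ^+ 6) * (1 - u ^+ 2 * w ^+ 6) *
  (1 - u ^+ 3 * w ^+ 6) * (1 - u ^+ 4 * w ^+ 6) * (1 - u ^+ 5 * w ^+ 6) *
  (1 - u ^+ 6 * w ^+ 6) ^+ 3)); first by ring.
by rewrite IH; ring.
Qed.

(** * 3-dissections of the theta series *)

(** Presents triangular exponents as quadratic polynomials, for use by [lia]. *)
Lemma bin2_double n : (2 * 'C(n.+1, 2) = n.+1 * n)%N.
Proof. by elim: n => [|n IH] //; rewrite binS bin1 mulnDr IH; lia. Qed.

Lemma theta_sumS (R : comPzRingType) (x y : R) M : theta_sum x y M.+1 =
  theta_sum x y M + (x ^+ 'C(M.+2, 2) * y ^+ 'C(M.+1, 2)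
                     + x ^+ 'C(M.+1, 2) * y ^+ 'C(M.+2, 2)).
Proof. by rewrite /theta_sum big_ord_recr addrA. Qed.

Lemma sub3_theta_sum x y M : sub3 (theta_sum x y M) = theta_sum (sub3 x) (sub3 y) M.
Proof.
rewrite /theta_sum rmorphD rmorph1 rmorph_sum; congr (_ + _); apply: eq_bigr => m _.
by rewrite rmorphD !rmorphM !rmorphXn.
Qed.

(** The sum of r^(m^2) is split by m mod 3. The classes 3j + 1 and 3j - 1 are exchanged by m -> -m,
    whence the 2. With the bound [(3 * M).+1] every class runs exactly over |j| <= M. *)
Lemma theta_sum_dissect_square (R : comPzRingType) (r : R) M :
  theta_sum r r (3 * M).+1 = theta_sum (r ^+ 9) (r ^+ 9) M +
    2 * (r * theta_sum (r ^+ 3) (r ^+ 15) M).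
Proof.
elim: M => [|M IH].
  by rewrite theta_sumS /theta_sum !big_ord0 binn bin_small //; ring.
have -> : (3 * M.+1 = (3 * M).+3)%N by lia.
rewrite 3!(theta_sumS r r) 2!(theta_sumS _ _ M) IH -!exprM -!exprD.
have e1 := bin2_double M; have e2 := bin2_double M.+1.
have f1 := bin2_double (3 * M).+1; have f2 := bin2_double (3 * M).+2.
have f3 := bin2_double (3 * M).+3; have f4 := bin2_double (3 * M).+4.
rewrite (addnC 'C((3 * M).+2, 2)) (addnC 'C((3 * M).+3, 2) 'C((3 * M).+4, 2)).
rewrite (addnC 'C((3 * M).+4, 2) 'C((3 * M).+1.+4, 2)).
have -> : ('C((3 * M).+3, 2) + 'C((3 * M).+2, 2) =
           (3 * 'C(M.+2, 2) + 15 * 'C(M.+1, 2)).+1)%N by lia.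
have -> : ('C((3 * M).+4, 2) + 'C((3 * M).+3, 2) =
           9 * 'C(M.+2, 2) + 9 * 'C(M.+1, 2))%N by lia.
have -> : ('C((3 * M).+1.+4, 2) + 'C((3 * M).+4, 2) =
           (3 * 'C(M.+1, 2) + 15 * 'C(M.+2, 2)).+1)%N by lia.
rewrite (addnC (9 * 'C(M.+1, 2))%N) !(exprS r).
set a := r ^+ _; set b := r ^+ _; set c := r ^+ _.
set d := theta_sum _ _ _; set e := theta_sum _ _ _.
by move: a b c d e => a b c d e; ring.
Qed.

(** The sum of r^(m(m-1)/2) is split by m mod 3. The reflection m -> 1 - m exchanges the classes 0
    and 1 and preserves the class 2, which gives the last term. *)
Lemma theta_sum_dissect_triangular (R : comPzRingType) (r : R) M :
  theta_sum 1 r (3 * M).+1 = theta_sum (r ^+ 3) (r ^+ 6) M *+ 2 +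
    r * theta_sum 1 (r ^+ 9) M.
Proof.
elim: M => [|M IH].
  by rewrite theta_sumS /theta_sum !big_ord0 binn bin_small // !expr1n; ring.
have -> : (3 * M.+1 = (3 * M).+3)%N by lia.
rewrite 3!(theta_sumS 1 r) 2!(theta_sumS _ _ M) IH -!exprM -!exprD !expr1n !mul1r.
have e1 := bin2_double M; have e2 := bin2_double M.+1.
have f1 := bin2_double (3 * M).+1; have f2 := bin2_double (3 * M).+2.
have f3 := bin2_double (3 * M).+3; have f4 := bin2_double (3 * M).+4.
have -> : ('C((3 * M).+2, 2) = (9 * 'C(M.+1, 2)).+1)%N by lia.
have -> : ('C((3 * M).+3, 2) = 3 * 'C(M.+2, 2) + 6 * 'C(M.+1, 2))%N by lia.
have -> : ('C((3 * M).+4, 2) = 3 * 'C(M.+1, 2) + 6 * 'C(M.+2, 2))%N by lia.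
have -> : ('C((3 * M).+1.+4, 2) = (9 * 'C(M.+2, 2)).+1)%N by lia.
rewrite !(exprS r).
set a := r ^+ _; set b := r ^+ _; set c := r ^+ _; set d := r ^+ _.
set e := theta_sum _ _ _; set f := theta_sum _ _ _.
by move: a b c d e f => a b c d e f; ring.
Qed.

Lemma phi_dissect : phi = sub3 (sub3 phi) - 2 * (q * sub3 theta_O).
Proof.
apply: eqm_eq => M; have leM : (M <= (3 * M).+1)%N by lia.
apply: eqm_trans (eqm_sym (eqm_leq leM (@theta_phi _))) _.
apply: eqm_trans (eqmB (eqm_sub3 (eqm_sub3 (@theta_phi M)))
  (eqmMl 2 (eqmMl q (eqm_sub3 (@theta_theta_O M))))).
have sN : sub3 (- q) = (- q) ^+ 3 by rewrite rmorphN /= sub3_q; ring.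
have -> : q * -1 = - q by ring.
have -> : q * (- q ^+ 4) = (- q) ^+ 5 by ring.
rewrite theta_sum_dissect_square !sub3_theta_sum rmorphXn /= !sN rmorphXn /= sN -!exprM.
suff -> (t : series) : 2 * (- q * t) = - (2 * (q * t)) by [].
by ring.
Qed.

Lemma psi_dissect : psi = sub3 theta_A + q * sub3 (sub3 psi).
Proof.
(* [theta_psi] describes twice [psi]; [mulsnI 1] cancels that 2. *)
apply: (@mulsnI 1); apply: eqm_eq => M; have leM : (M <= (3 * M).+1)%N by lia.
apply: eqm_trans (eqm_sym (eqm_leq leM (@theta_psi _))) _.
have -> : (sub3 theta_A + q * sub3 (sub3 psi)) *+ 2 =
    sub3 theta_A *+ 2 + q * sub3 (sub3 (psi *+ 2)) by rewrite !rmorphMn /=; ring.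
have eA := eqm_sub3 (@theta_theta_A M).
rewrite [sub3 theta_A *+ 2]mulr2n.
apply: eqm_trans (eqmD (eqmD eA eA) (eqmMl q (eqm_sub3 (eqm_sub3 (@theta_psi M))))).
rewrite mulr1 theta_sum_dissect_triangular !sub3_theta_sum !rmorph1 !rmorphM /= !sub3_q.
by rewrite rmorphXn /= sub3_q -!exprM -exprD -mulr2n.
Qed.

(** * The cubic continued fraction *)

Lemma coef0_phi : phi 0%N = 1.
Proof. by rewrite phi.unlock coef0M coef0X coef0V !coef0_euler. Qed.
Lemma coef0_psi : psi 0%N = 1.
Proof. by rewrite psi.unlock coef0M coef0X coef0V !coef0_euler. Qed.

Lemma mulVs (n d : series) : n 0%N = 1 -> d * inv_series n * n = d.
Proof. by move=> n0; rewrite mulrAC -mulrA mulsV ?mulr1. Qed.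

Lemma phi_euler : phi * euler 2 = euler 1 ^+ 2.
Proof. by rewrite phi.unlock mulVs ?coef0_euler. Qed.
Lemma psi_euler : psi * euler 1 = euler 2 ^+ 2.
Proof. by rewrite psi.unlock mulVs ?coef0_euler. Qed.

Lemma phi_psi : phi * psi = euler 1 * euler 2.
Proof.
apply: (@mulsI (euler 1 * euler 2)); first by rewrite coef0M !coef0_euler.
have := phi_euler; have := psi_euler.
move: phi psi (euler 1) (euler 2) => a b c d e1 e2.
transitivity (a * d * (b * c)); first by ring.
by rewrite e1 e2; ring.
Qed.

(** Both sides equal f_3 f_6. *)
Lemma theta_A_theta_O : theta_A * theta_O = sub3 phi * sub3 psi.
Proof.
rewrite -rmorphM /= phi_psi rmorphM /= !sub3_euler //.
have n1 : (euler 1 * euler 6) 0%N = 1 by rewrite coef0M !coef0_euler.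
have n2 : (euler 2 * euler 3) 0%N = 1 by rewrite coef0M !coef0_euler.
apply: (mulsI n1); apply: (mulsI n2).
have e1 : theta_O * (euler 2 * euler 3) = euler 1 * euler 6 ^+ 2 by rewrite theta_O.unlock mulVs.
have : theta_A * (euler 1 * euler 6) = euler 2 * euler 3 ^+ 2 by rewrite theta_A.unlock mulVs.
move: e1.
move: theta_A theta_O (euler 1) (euler 2) (euler 3) (euler 6) => a b c d e f e1 e2.
transitivity (a * (c * f) * (b * (d * e))); first by ring.
by rewrite e1 e2; ring.
Qed.

Lemma norm3_phi : norm3 phi = sub3 phi ^+ 3 - 8 * (q * theta_O ^+ 3).
Proof.
have E (a b : series) : join3 a (- (2 * b)) 0 = sub3 a - 2 * (q * sub3 b).
  by rewrite /join3 rmorph0 rmorphN rmorphM rmorph_nat /=; ring.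
have {}E : phi = join3 (sub3 phi) (- (2 * theta_O)) 0 by rewrite E -phi_dissect.
rewrite {1}E norm3_join3; move: (sub3 phi) theta_O q => a b c; ring.
Qed.

(** The norm of [phi] computed twice: from its dissection, and from Euler products as (f_1^4 /
    f_3)^2 / (f_2^4 / f_6) = phi^4 / phi(q^3). *)
Lemma phi_norm : (sub3 phi ^+ 3 - 8 * (q * theta_O ^+ 3)) * sub3 phi = phi ^+ 4.
Proof.
rewrite -norm3_phi; apply: (@mulsI (euler 2 ^+ 4)); first by rewrite coef0X !coef0_euler.
have e1 : norm3 phi * norm3 (euler 2) = norm3 (euler 1) ^+ 2.
  by rewrite -norm3M phi_euler !expr2 norm3M.
have e2 : norm3 (euler 1) * euler 3 = euler 1 ^+ 4 by exact: norm3_euler.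
have e3 : norm3 (euler 2) * euler 6 = euler 2 ^+ 4 by exact: norm3_euler.
have e4 : sub3 phi * euler 6 = euler 3 ^+ 2.
  by rewrite -(@sub3_euler 1 isT) -(@sub3_euler 2 isT) -rmorphM phi_euler rmorphXn.
have := phi_euler; move: e1 e2 e3 e4.
move: phi (sub3 phi) (norm3 phi) (euler 1) (euler 2) (euler 3) (euler 6).
move=> a b c f g h i e1 e2 e3 e4 e5.
rewrite -{1}e3; transitivity (c * norm3 g * (b * i)); first by ring.
rewrite e1 e4; transitivity ((norm3 f * h) ^+ 2); first by ring.
by rewrite e2; transitivity ((a * g) ^+ 4); [rewrite e5|]; ring.
Qed.

(* The cubic continued fraction is q^(1/3) [ccf]; [ccf_cube] is its cube, and [ccf_q3] is
   its value at q^3. *)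
HB.lock Definition ccf := theta_O * inv_series (sub3 phi).
HB.lock Definition ccf_cube := q * ccf ^+ 3.
HB.lock Definition ccf_q3 := q * sub3 ccf.

Lemma ccfE : ccf * sub3 phi = theta_O.
Proof. by rewrite ccf.unlock mulVs // coef0_sub3 coef0_phi. Qed.

Lemma sub3_ccf_cube : sub3 ccf_cube = ccf_q3 ^+ 3.
Proof. by rewrite ccf_cube.unlock ccf_q3.unlock rmorphM rmorphXn /= sub3_q exprMn; ring. Qed.

Lemma coef0_ccf_cube : ccf_cube 0%N = 0.
Proof. by rewrite ccf_cube.unlock coef0M coef_q mul0r. Qed.
Lemma coef0_ccf_q3 : ccf_q3 0%N = 0.
Proof. by rewrite ccf_q3.unlock coef0M coef_q mul0r. Qed.

Lemma phi_ccf_q3 : phi = sub3 (sub3 phi) * (1 - 2 * ccf_q3).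
Proof.
rewrite {1}phi_dissect -ccfE (rmorphM sub3 ccf) ccf_q3.unlock /=.
by move: (sub3 (sub3 phi)) (sub3 ccf) q => a b c; ring.
Qed.

Lemma theta_A_ccf_q3 : sub3 theta_A * ccf_q3 = q * sub3 (sub3 psi).
Proof.
rewrite ccf_q3.unlock mulrCA -rmorphM; congr (q * sub3 _).
apply: (@mulsI (sub3 phi)); first exact: coef0_phi.
by rewrite -theta_A_theta_O -ccfE; move: theta_A ccf (sub3 phi) => a b c; ring.
Qed.

Lemma psi_ccf_q3 : psi = sub3 theta_A * (1 + ccf_q3).
Proof. by rewrite mulrDr mulr1 theta_A_ccf_q3 -psi_dissect. Qed.

Lemma ccf_cube_phi : (1 - 8 * ccf_cube) * sub3 phi ^+ 4 = phi ^+ 4.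
Proof. by rewrite -phi_norm -ccfE ccf_cube.unlock; move: (sub3 phi) ccf q => a b c; ring. Qed.

(** With v = [ccf_q3] and w = [ccf_cube], 1 - 8 w and 1 - 8 v^3 are the fourth powers of phi(q) /
    phi(q^3) and phi(q^3) / phi(q^9). Their product is (1 - 2 v)^4, and one factor 1 - 2 v
    cancels. *)
Lemma ccf_cube_ccf_q3 :
  (1 - 8 * ccf_cube) * (1 + 2 * ccf_q3 + 4 * ccf_q3 ^+ 2) = (1 - 2 * ccf_q3) ^+ 3.
Proof.
have c1 : (1 - 2 * ccf_q3) 0%N = 1.
  by rewrite coef_sB coef0M coef0_ccf_q3 mulr0 subr0 coef_s1.
apply: (mulsI c1).
apply: (@mulsI (sub3 (sub3 phi) ^+ 4)); first by rewrite coef0X !coef0_sub3 coef0_phi.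
have e1 : (1 - 8 * ccf_q3 ^+ 3) * sub3 (sub3 phi) ^+ 4 = sub3 phi ^+ 4.
  have := congr1 sub3 ccf_cube_phi; rewrite (rmorphM sub3 (1 - 8 * ccf_cube)) (rmorphB sub3 1).
  by rewrite rmorph1 (rmorphM sub3 8) rmorph_nat !(rmorphXn sub3) /= sub3_ccf_cube.
have := ccf_cube_phi; have := phi_ccf_q3; move: e1.
move: phi (sub3 phi) (sub3 (sub3 phi)) ccf_q3 ccf_cube => a b c v w e1 e2 e3.
transitivity (((1 - 8 * v ^+ 3) * c ^+ 4) * (1 - 8 * w)); first by ring.
by rewrite e1 mulrC e3 e2; ring.
Qed.

Lemma ccf_cubeE :
  ccf_cube * (1 + 2 * ccf_q3 + 4 * ccf_q3 ^+ 2) = ccf_q3 * (1 - ccf_q3 + ccf_q3 ^+ 2).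
Proof.
(* Solving the previous relation for w produces a factor 8, cancelled here. *)
apply: (@mulsnI 7); have := ccf_cube_ccf_q3; move: ccf_q3 ccf_cube => v w e.
transitivity (1 + 2 * v + 4 * v ^+ 2 - (1 - 8 * w) * (1 + 2 * v + 4 * v ^+ 2)); first by ring.
by rewrite e; ring.
Qed.

(* The shift by q turns a9 n into the coefficient of index n + 1. *)
HB.lock Definition agen := q * (euler 9 * euler 18 * inv_series (euler 1 * euler 2)).

(** The denominator f_1 f_2 is [phi * psi], and both factors are dissected in terms of v = [ccf_q3];
    hence [agen] is v / ((1 - 2 v)(1 + v)). *)
Lemma agen_ccf_q3 : agen * ((1 - 2 * ccf_q3) * (1 + ccf_q3)) = ccf_q3.
Proof.
apply: (@mulsI (sub3 (sub3 phi) * sub3 theta_A)).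
  have c1 := congr1 (fun s : series => s 0%N) psi_ccf_q3.
  move: c1; rewrite coef0_psi coef0M coef_sD coef0_ccf_q3 addr0 coef_s1 mulr1 => c1.
  by rewrite coef0M -c1 mulr1 !coef0_sub3 coef0_phi.
have n1 : (euler 1 * euler 2) 0%N = 1 by rewrite coef0M !coef0_euler.
have e0 : agen * (phi * psi) = q * (sub3 (sub3 phi) * sub3 (sub3 psi)).
  rewrite -(rmorphM sub3 (sub3 phi)) -(rmorphM sub3 phi) phi_psi.
  have s1 : sub3 (sub3 (euler 1)) = euler 9.
    by rewrite (@sub3_euler 1 isT) (@sub3_euler 3 isT).
  have s2 : sub3 (sub3 (euler 2)) = euler 18.
    by rewrite (@sub3_euler 2 isT) (@sub3_euler 6 isT).
  rewrite (rmorphM sub3 (euler 1)) (rmorphM sub3 (sub3 (euler 1))) /= s1 s2.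
  by rewrite agen.unlock -[q * _ * _]mulrA (mulVs _ n1).
have gen (R : comPzRingType) (a b c d e f g h : R) : g * (a * b) = f * (d * e) ->
    a = d * (1 - 2 * h) -> b = c * (1 + h) -> c * h = f * e ->
    d * c * (g * ((1 - 2 * h) * (1 + h))) = d * c * h.
  move=> E0 E1 E2 E3; transitivity (g * (a * b)); first by rewrite E1 E2; ring.
  by rewrite E0; transitivity (d * (f * e)); [ring | rewrite -E3; ring].
exact: gen e0 phi_ccf_q3 psi_ccf_q3 theta_A_ccf_q3.
Qed.

(* One third of the U-image of [agen]. *)
HB.lock Definition agen3 := ccf_cube * inv_series ((1 - 8 * ccf_cube) * (1 + ccf_cube)).

Lemma coef0_normw : ((1 - 8 * ccf_cube) * (1 + ccf_cube)) 0%N = 1.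
Proof.
by rewrite coef0M coef_sB coef_sD coef0M coef0_ccf_cube mulr0 subr0 ?addr0 coef_s1 mul1r.
Qed.

Lemma agen3E : agen3 * ((1 - 8 * ccf_cube) * (1 + ccf_cube)) = ccf_cube.
Proof. by rewrite agen3.unlock mulVs // coef0_normw. Qed.

Lemma coef0_dd : ((1 - 2 * ccf_q3) * (1 + ccf_q3)) 0%N = 1.
Proof.
by rewrite coef0M coef_sB coef_sD coef0M coef0_ccf_q3 mulr0 subr0 ?addr0 coef_s1 mul1r.
Qed.

(** In terms of v, 1 - 8 w and 1 + w are (1 - 2 v)^3 and (1 + v)^3 over 1 + 2 v + 4 v^2. With d = (1
    - 2 v)(1 + v), the claim becomes d^2 + 3 v d + 9 v^2 = (1 - v + v^2)(1 + 2 v + 4 v^2). *)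
Lemma agen3_agen : agen3 = agen + 3 * agen ^+ 2 + 9 * agen ^+ 3.
Proof.
apply: (@mulsI (((1 - 2 * ccf_q3) * (1 + ccf_q3)) ^+ 3)); first by rewrite coef0X coef0_dd.
have := agen3E; have := agen_ccf_q3; have := ccf_cube_ccf_q3; have := ccf_cubeE.
move: agen3 agen ccf_q3 ccf_cube => t u v w e1 e2 e3 e4.
have e5 : (1 + w) * (1 + 2 * v + 4 * v ^+ 2) = (1 + v) ^+ 3 by rewrite mulrDl e1; ring.
set d := (1 - 2 * v) * (1 + v) in e3 *.
transitivity (v * d ^+ 2 + 3 * v ^+ 2 * d + 9 * v ^+ 3); last by rewrite -e3; ring.
rewrite /d exprMn -e2 -e5.
transitivity (t * ((1 - 8 * w) * (1 + w)) * (1 + 2 * v + 4 * v ^+ 2) ^+ 2); first by ring.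
rewrite e4; transitivity (w * (1 + 2 * v + 4 * v ^+ 2) * (1 + 2 * v + 4 * v ^+ 2)).
  by ring.
by rewrite e1; ring.
Qed.

(** At q^3 the denominator of [agen3] is (1 - 8 v^3)(1 + v^3) = d (1 - v + v^2)(1 + 2 v + 4 v^2), so
    the same polynomial identity applies. *)
Lemma agen_cubic : agen ^+ 3 = sub3 agen3 * (1 + 3 * agen + 9 * agen ^+ 2).
Proof.
have n1 : ((1 - 8 * ccf_q3 ^+ 3) * (1 + ccf_q3 ^+ 3)) 0%N = 1.
  rewrite coef0M coef_sB coef_sD coef0M coef0X coef0_ccf_q3 expr0n mulr0 subr0 ?addr0.
  by rewrite coef_s1 mul1r.
apply: (@mulsI (((1 - 2 * ccf_q3) * (1 + ccf_q3)) ^+ 3)); first by rewrite coef0X coef0_dd.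
apply: (mulsI n1).
have e1 : sub3 agen3 * ((1 - 8 * ccf_q3 ^+ 3) * (1 + ccf_q3 ^+ 3)) = ccf_q3 ^+ 3.
  have := congr1 sub3 agen3E; rewrite (rmorphM sub3 agen3) (rmorphM sub3 (1 - 8 * ccf_cube)).
  by rewrite rmorphB rmorphD (rmorphM sub3 8) rmorph1 rmorph_nat /= sub3_ccf_cube.
have := agen_ccf_q3; move: e1; move: (sub3 agen3) agen ccf_q3 => t u v e1.
set d := _ * (1 + v) => e2.
transitivity ((u * d) ^+ 3 * ((1 - 8 * v ^+ 3) * (1 + v ^+ 3))); first by ring.
rewrite e2.
transitivity (t * ((1 - 8 * v ^+ 3) * (1 + v ^+ 3)) *
  (d * (d ^+ 2 + 3 * (u * d) * d + 9 * (u * d) ^+ 2))).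
  by rewrite e1 e2 /d; ring.
by ring.
Qed.

(** * Trisection of the powers of [agen] *)

(** Clearing the denominator to one in v^3 leaves v + v^2 + 3 v^3 - 2 v^4 + 4 v^5. As v is q times a
    series in q^3, exponents of v modulo 3 sort the terms. *)
Lemma agen_sub3 :
  sub3 ((1 - 8 * ccf_cube) * (1 + ccf_cube)) * agen =
  join3 (3 * ccf_cube) (ccf - 2 * ccf_cube * ccf) (ccf ^+ 2 + 4 * ccf_cube * ccf ^+ 2).
Proof.
rewrite (rmorphM sub3 (1 - 8 * ccf_cube)) (rmorphB sub3 1) (rmorphD sub3 1) rmorph1.
rewrite (rmorphM sub3 8) rmorph_nat /= sub3_ccf_cube /join3.
rewrite (rmorphM sub3 3) (rmorphB sub3 ccf) (rmorphD sub3 (ccf ^+ 2)).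
rewrite !(rmorphM sub3 _ ccf) (rmorphM sub3 _ (ccf ^+ 2)) !(rmorphM sub3 _ ccf_cube).
rewrite !rmorph_nat /= (rmorphXn sub3 2 ccf) /= sub3_ccf_cube.
have vE : ccf_q3 = q * sub3 ccf by rewrite ccf_q3.unlock.
apply: (mulsI coef0_dd).
have := agen_ccf_q3; move: agen ccf_q3 (sub3 ccf) q vE => u v y r vE e.
transitivity ((1 - 8 * v ^+ 3) * (1 + v ^+ 3) * (u * ((1 - 2 * v) * (1 + v)))).
  by ring.
by rewrite e vE; ring.
Qed.

Lemma sect3_agen : sect3 0 agen = 3 * agen3.
Proof.
apply: (mulsI coef0_normw); rewrite -sect3_sub3M // agen_sub3.
set a := _ * ccf_cube; set b := ccf - _; set c := _ + _.
have [-> _ _] := sect3_join3 a b c; rewrite /a.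
have := agen3E; move: agen3 ccf_cube => t w e.
by transitivity (3 * (t * ((1 - 8 * w) * (1 + w)))); [rewrite e | ring].
Qed.

(** For a dissection a, b, c, the zeroth part of the square is a^2 + 2 q b c. Here it equals 2 w D +
    27 w^2, where D = (1 - 8 w)(1 + w) is the denominator of [agen3]. *)
Lemma sect3_agen2 : sect3 0 (agen ^+ 2) = 2 * agen3 + 27 * agen3 ^+ 2.
Proof.
apply: (mulsI coef0_normw); apply: (mulsI coef0_normw).
rewrite -!sect3_sub3M //.
set N := sub3 _; have -> : N * (N * agen ^+ 2) = (N * agen) * (N * agen).
  by move: N agen => a b; ring.
rewrite agen_sub3 join3M.
set a := (X in join3 X _ _); set b := (X in join3 _ X _); set c := (X in join3 _ _ X).
have [-> _ _] := sect3_join3 a b c; rewrite /a.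
have wE : ccf_cube = q * ccf ^+ 3 by rewrite ccf_cube.unlock.
have := agen3E; move: q agen3 ccf_cube ccf wE => r t w y wE e.
transitivity (2 * w * ((1 - 8 * w) * (1 + w)) + 27 * w ^+ 2).
  transitivity (9 * w ^+ 2 + 2 * (r * y ^+ 3) * (1 - 2 * w) * (1 + 4 * w)); first by ring.
  by rewrite -wE; ring.
by rewrite -{1 4}e; ring.
Qed.

(** The cubic equation times [agen ^+ n]; its coefficient in q^3 passes through U. *)
Lemma sect3_agenS n : sect3 0 (agen ^+ n.+3) =
  agen3 * (sect3 0 (agen ^+ n) + 3 * sect3 0 (agen ^+ n.+1) + 9 * sect3 0 (agen ^+ n.+2)).
Proof.
have -> : agen ^+ n.+3 = sub3 agen3 * (agen ^+ n + (agen ^+ n.+1) *+ 3 + (agen ^+ n.+2) *+ 9).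
  transitivity (agen ^+ n * agen ^+ 3); first by rewrite -exprD addn3.
  rewrite agen_cubic !(exprS _ n) (exprS _ n.+1) (exprS _ n).
  by move: (agen ^+ n) agen (sub3 agen3) => a u t; ring.
rewrite sect3_sub3M //; congr (_ * _).
by rewrite 2!raddfD /= !raddfMn /=; ring.
Qed.

(** * Divisibility under iterated trisection *)

(** Integer combinations of positive powers. The power 0 is left out because U fixes 1 and gains no
    factor 3 there. *)
Inductive power_span (z : series) : series -> Prop :=
| PowerSpanX i : power_span z (z ^+ i.+1)
| PowerSpanB s t : power_span z s -> power_span z t -> power_span z (s - t).

Lemma power_span1 z : power_span z z.
Proof. exact: (PowerSpanX z 0). Qed.
Lemma power_span0 z : power_span z 0.
Proof. by rewrite -(subrr (z ^+ 1)); apply: PowerSpanB; apply: PowerSpanX. Qed.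
Lemma power_spanD z s t : power_span z s -> power_span z t -> power_span z (s + t).
Proof.
move=> zs zt; rewrite -[t]opprK -[- t]add0r.
by do 2?apply: PowerSpanB => //; apply: power_span0.
Qed.
Lemma power_spanMn z s n : power_span z s -> power_span z (s *+ n).
Proof.
move=> zs; elim: n => [|n IH]; first exact: power_span0.
by rewrite mulrS; apply: power_spanD.
Qed.
Lemma power_spanM z s t : power_span z s -> power_span z t -> power_span z (s * t).
Proof.
move=> zs; elim=> [j|t1 t2 _ IH1 _ IH2]; last by rewrite mulrBr; apply: PowerSpanB.
elim: zs => [i|s1 s2 _ IH1 _ IH2]; last by rewrite mulrBl; apply: PowerSpanB.
by rewrite -exprD addSn; apply: PowerSpanX.
Qed.

(** The series z of the introduction; [step3] is one third of its S. *)
Definition agen_x3 := 3 * agen.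
Definition step3 := agen_x3 + agen_x3 ^+ 2 + agen_x3 ^+ 3.

Lemma step3_agen3 : 9 * agen3 = 3 * step3.
Proof. by rewrite /step3 /agen_x3 agen3_agen; move: agen => u; ring. Qed.

Lemma sect3_agen_x3X n : sect3 0 (agen_x3 ^+ n) = sect3 0 (agen ^+ n) *+ 3 ^ n.
Proof.
have -> : agen_x3 ^+ n = agen ^+ n *+ 3 ^ n by rewrite /agen_x3 exprMn -natrX mulr_natl.
by rewrite raddfMn.
Qed.

Lemma power_span_step3 : power_span agen_x3 step3.
Proof.
apply: power_spanD; last exact: PowerSpanX.
by apply: power_spanD; [apply: power_span1 | apply: PowerSpanX].
Qed.

Lemma sect3_agen_x3 n : exists2 r, power_span agen_x3 r & sect3 0 (agen_x3 ^+ n.+1) = 3 * r.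
Proof.
have sz : power_span agen_x3 step3 := power_span_step3.
have e0 : sect3 0 (agen_x3 ^+ 1) = 3 * step3.
  by rewrite sect3_agen_x3X !expr1 expn1 sect3_agen -step3_agen3; move: agen3 => t; ring.
have e1 : sect3 0 (agen_x3 ^+ 2) = 3 * (step3 *+ 2 + step3 ^+ 2 *+ 9).
  rewrite sect3_agen_x3X sect3_agen2.
  transitivity (2 * (9 * agen3) + 3 * (9 * agen3) ^+ 2); first by move: agen3 => t; ring.
  by rewrite step3_agen3; move: step3 => t; ring.
have eS m : sect3 0 (agen_x3 ^+ m.+3) =
    3 * (step3 * (sect3 0 (agen_x3 ^+ m) + sect3 0 (agen_x3 ^+ m.+1)
                  + sect3 0 (agen_x3 ^+ m.+2)) *+ 3).
  rewrite !sect3_agen_x3X sect3_agenS !expnS.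
  move: (sect3 0 _) (sect3 0 _) (sect3 0 _) (3 ^ m)%N => c b a d.
  rewrite -[LHS]mulr_natr -[a *+ _]mulr_natr -[b *+ _]mulr_natr -[c *+ _]mulr_natr !natrM.
  move: (d%:R : series) => e.
  transitivity ((9 * agen3) * ((a + b *+ 3 + c *+ 9) * e) *+ 3); last by rewrite step3_agen3; ring.
  by move: agen3 => t; ring.
have tz2 : power_span agen_x3 (step3 *+ 2 + step3 ^+ 2 *+ 9).
  by apply: power_spanD; apply: power_spanMn => //; apply: power_spanM.
have s1 : sect3 0 1 = 1.
  by apply: seriesP => k; rewrite /= !coef1 addn0 muln_eq0.
pose P m := exists2 r, power_span agen_x3 r & sect3 0 (agen_x3 ^+ m.+1) = 3 * r.
have P0 : P 0%N by exists step3.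
have P1 : P 1%N by exists (step3 *+ 2 + step3 ^+ 2 *+ 9).
(* A separate base case: the recurrence then involves U(1) = 1, which the factor [step3] brings back
   into the span. *)
have P2 : P 2%N.
  exists ((step3 + step3 * (step3 *+ 3) + step3 * ((step3 *+ 2 + step3 ^+ 2 *+ 9) *+ 3)) *+ 3).
    apply: power_spanMn; do 2?apply: power_spanD => //; apply: power_spanM => //;
      exact: power_spanMn.
  by rewrite eS expr0 s1 e0 e1; move: step3 => t; ring.
have PS m : P m -> P m.+1 -> P m.+2 -> P m.+3.
  move=> [a za ea] [b zb eb] [c zc ec]; exists (step3 * ((a + b + c) *+ 3) *+ 3).
    by apply: power_spanMn; apply: power_spanM => //; apply: power_spanMn; do 2?apply: power_spanD.
  by rewrite eS ea eb ec; ring.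
suff [] : P n /\ P n.+1 /\ P n.+2 by [].
by elim: n => [|n [Pa [Pb Pc]]] //; do 2!split => //; apply: PS.
Qed.

Lemma sect3_power_span s : power_span agen_x3 s ->
  exists2 r, power_span agen_x3 r & sect3 0 s = 3 * r.
Proof.
elim=> [n|a b _ [a' za ea] _ [b' zb eb]]; first exact: sect3_agen_x3.
by exists (a' - b'); [apply: PowerSpanB | rewrite raddfB /= ea eb mulrBr].
Qed.

(** Supplies the factor 3 that is lost in passing from [agen_x3] back to [agen]. *)
Lemma power_span_mul3 s : power_span agen_x3 s -> exists r, s = r *+ 3.
Proof.
elim=> [n|a b _ [a' ->] _ [b' ->]]; last by exists (a' - b'); rewrite mulrnBl.
by exists (agen * agen_x3 ^+ n); rewrite exprS /agen_x3; ring.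
Qed.

Lemma iter_sect3_agen k : exists r, iter k (sect3 0) agen = r *+ 3 ^ k.
Proof.
have [s zs es] : exists2 s, power_span agen_x3 s & iter k (sect3 0) agen_x3 = s *+ 3 ^ k.
  elim: k => [|k [s zs es]]; first by exists agen_x3; [apply: power_span1|].
  have [r zr er] := sect3_power_span zs; exists r => //=.
  by rewrite es raddfMn /= er expnS mulrnA; congr (_ *+ _); ring.
have [r er] := power_span_mul3 zs; exists r; apply: (@mulsnI 2).
have <- : iter k (sect3 0) agen_x3 = iter k (sect3 0) agen *+ 3.
  elim: (k) => [|j IH] /=; first by rewrite /agen_x3; ring.
  by rewrite IH raddfMn.
by rewrite es er mulrnAC.
Qed.

(** * Return to the coefficients of the generating function *)

Lemma iter_sect3_coef k (s : series) n : iter k (sect3 0) s n = s (3 ^ k * n)%N.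
Proof.
elim: k n => [|k IH] n; first by rewrite mul1n.
by rewrite iterS /= IH addn0 mulnA -expnSr.
Qed.

(** One index better than [euler_eqm]: the next factor is 1 up to index [n], the index that [a9 n]
    extracts. *)
Lemma euler_eqmS k n : (0 < k)%N -> eqm n.+1 (euler k) (qfact (q ^+ k) n).
Proof.
move=> k0; apply: eqm_trans (euler_eqm k0 (leqnn _)) _.
by rewrite (qXE k0); apply: qfact_eqm.
Qed.

(** Both series are compared after multiplication by f_1 f_2; a truncated geometric sum inverts 1 -
    q^k up to index [n] because k (n + 1) > n. *)
Lemma coef_agen n : agen n.+1 = a9 n.
Proof.
rewrite agen.unlock -[q in LHS]expr1 coef_qXM subn1 /=.
suff e : eqm n.+1 (euler 9 * euler 18 * inv_series (euler 1 * euler 2))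
    (poly_series (gen9_trunc n)) by apply: e.
have n1 : (euler 1 * euler 2) 0%N = 1 by rewrite coef0M !coef0_euler.
apply: (eqm_mulI n1); rewrite mulrCA mulsV // mulr1.
apply: eqm_trans (eqmM (@euler_eqmS 9 n isT) (@euler_eqmS 18 n isT)) _.
apply: eqm_sym.
apply: eqm_trans (eqmM (eqmM (@euler_eqmS 1 n isT) (@euler_eqmS 2 n isT)) (@eqm_refl _ _)) _.
rewrite /gen9_trunc rmorph_prod big_add1 /= big_mkord -!big_split /=.
apply: eqm_prod => i _.
have geom k : (0 < k)%N ->
    eqm n.+1 ((1 - q ^+ k) * poly_series (geom_trunc n k)) 1.
  move=> k0; rewrite /geom_trunc rmorph_sum /= big_mkord.
  have -> : (1 - q ^+ k) * (\sum_(j < n.+1) poly_series 'X^(k * j)) = 1 - q ^+ (k * n.+1).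
    have := subrXX 1 (q ^+ k) n.+1; rewrite expr1n -exprM => ->; congr (_ * _).
    by apply: eq_bigr => j _; rewrite expr1n mul1r -exprM rmorphXn.
  rewrite -[X in eqm _ _ X]subr0; apply: eqmB => //.
  by rewrite -[q ^+ _]mulr1; apply: eqm_qX; rewrite leq_pmull.
rewrite !rmorphM !rmorphB rmorph1 !rmorphXn /= -/q -!exprM mul1n.
have g1 := @geom i.+1 isT; have g2 : eqm n.+1 _ 1 := @geom (2 * i.+1)%N isT.
set a := 1 - q ^+ (9 * _); set b := 1 - q ^+ (18 * _).
have := eqmMl (a * b) (eqmM g1 g2); rewrite !mulr1.
apply: eqm_trans; set c := _ - _; set d := _ - _; set e := poly_series _; set f := poly_series _.
by have -> : c * d * (a * b * e * f) = a * b * (c * e * (d * f)) by ring.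
Qed.

Theorem theorem1p2 (alpha n : nat) :
  ((3 ^ alpha.+1)%N%:Z %| a9 (3 ^ alpha.+1 * n + 3 ^ alpha.+1 - 1)%N)%Z.
Proof.
have [r er] := iter_sect3_agen alpha.+1.
(* The shift by [q] absorbs the - 1: the index in [agen] is [3 ^ alpha.+1 * n.+1]. *)
have -> : a9 (3 ^ alpha.+1 * n + 3 ^ alpha.+1 - 1)%N = (r *+ 3 ^ alpha.+1) n.+1.
  rewrite -er iter_sect3_coef -coef_agen mulnS addnC; congr (coefs agen _).
  by rewrite subn1 prednK // addn_gt0 expn_gt0.
by rewrite coef_sMn -mulr_natr natz dvdz_mull.
Qed.
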